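(* Suppose that: (i) for each $\pi\in\mathbb{S}$, $V\in\mathbb{R}^d$, $P\in\mathbb{S}^d$ and each index $1\le i\le d$, the mapping $q\mapsto e_i(\pi,\mathcal{P}(P,q,i),V)$, defined for $q\in\mathbb{S}$ with values in $\mathbb{R}$, is convex; and (ii) for all $i$ (and all $\pi\in\mathbb{S}$, $V\in\mathbb{R}^d$) the map $P\mapsto e_i(\pi,P,V)$ is continuous on $\mathbb{S}^d$. Then for any $\pi\in\mathbb{S}$ and $V\in\mathbb{R}^d$ there exists a Nash minimizer $P\in\mathbb{S}^d$ of $e(\pi,\cdot,V)$.
   Context: Let $d>1$ be an integer and $\mathbb{S}=\{(q_1,\dots,q_d): q_j\ge 0\ \forall j,\ \sum_{j=1}^d q_j=1\}$. The set of $d\times d$ (row-)stochastic matrices is identified with $\mathbb{S}^d$. Given transition costs $c_{ij}(\pi,P)$, $1\le i,j\le d$ (functions of $\pi\in\mathbb{S}$ and $P\in\mathbb{S}^d$), define $e_i(\pi,P,V)=\sum_j c_{ij}(\pi,P)P_{ij}+V_jP_{ij}$ (the sum over $j$ being of both terms) for $V\in\mathbb{R}^d$. For $P\in\mathbb{S}^d$, $q\in\mathbb{S}$, $\mathcal{P}(P,q,i)$ is the stochastic matrix obtained from $P$ by replacing its $i$-th row by $q$ and leaving all other rows unchanged. A matrix $P\in\mathbb{S}^d$ is a Nash minimizer of $e(\pi,\cdot,V)$ if for each $i\in\{1,\dots,d\}$ and any $q\in\mathbb{S}$, $e_i(\pi,P,V)\le e_i(\pi,\mathcal{P}(P,q,i),V)$.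 *)

(* Defs.v *)
From mathcomp Require Import all_boot all_order all_algebra.
From mathcomp Require Import all_classical all_reals all_analysis.
Import Order.TTheory GRing.Theory Num.Theory.
Import numFieldNormedType.Exports.

Set Implicit Arguments.
Unset Strict Implicit.
Unset Printing Implicit Defensive.

Local Open Scope classical_set_scope.
Local Open Scope ring_scope.

Section Defs.
Context {R : realType} {d : nat}.

Definition simplex : set 'rV[R]_d :=
  [set q | (forall j, 0 <= q 0 j) /\ \sum_j q 0 j = 1].

Definition stochastic : set 'M[R]_d :=
  [set P | forall i, simplex (row i P)].

(* The costs [c i j] are total functions of [(pi, P)]; below they only ever
   matter for [pi] in [simplex] and [P] in [stochastic]. *)
Definition avg_cost (c : 'I_d -> 'I_d -> 'rV[R]_d -> 'M[R]_d -> R)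
    (i : 'I_d) (pi : 'rV[R]_d) (P : 'M[R]_d) (V : 'rV[R]_d) : R :=
  \sum_j (c i j pi P * P i j + V 0 j * P i j).

Definition replace_row (P : 'M[R]_d) (q : 'rV[R]_d) (i : 'I_d) : 'M[R]_d :=
  \matrix_(k, j) if k == i then q 0 j else P k j.

Definition nash_minimizer (c : 'I_d -> 'I_d -> 'rV[R]_d -> 'M[R]_d -> R)
    (pi V : 'rV[R]_d) (P : 'M[R]_d) : Prop :=
  stochastic P /\
  forall (i : 'I_d) (q : 'rV[R]_d), simplex q ->
    avg_cost c i pi P V <= avg_cost c i pi (replace_row P q i) V.

End Defs.

(* Main.v *)
Require Import Defs.
From mathcomp Require Import all_boot zify.

Set Implicit Arguments.
Unset Strict Implicit.
Unset Printing Implicit Defensive.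

(* A stochastic matrix [P] is a Nash minimizer iff [0 <= psi P Q] for all
   stochastic [Q], where [psi P Q] is the sum over [i] of the changes of [e_i]
   when only row [i] of [P] is replaced by row [i] of [Q] (the Nikaido-Isoda
   function). Since [psi] is continuous in [P] and convex in [Q], and
   [psi P P = 0], such a [P] exists by Ky Fan's inequality. By compactness it is
   enough to treat finitely many [Q_k]; on their convex hull the inequality
   follows from a covering theorem for the simplex: closed sets [F_k] which cover
   it, with the facet [x_k = 0] contained in [F_k], have a common point. That
   theorem is the limit of Scarf's combinatorial lemma on the grids of mesh
   [1/N]; Scarf's lemma, a parity argument on families of total orders, replaces
   the triangulations of Sperner's lemma. *)

(** * Scarf's combinatorial lemma for families of total orders *)

Section Dominance.
Variables (I Z : finType) (rk : I -> Z -> nat).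
Hypothesis rk_inj : forall i, injective (rk i).
Implicit Types (t : {set Z}) (x y z : Z) (i j k l : I).

(** Scarf's primitive sets: no [y] lies strictly above the minimum of [t] in every order at once. *)
Definition dominant t : bool :=
  [forall y, exists i, forall x in t, rk i y <= rk i x].

Lemma dominantP t :
  reflect (forall y, exists i, forall x, x \in t -> rk i y <= rk i x)
          (dominant t).
Proof.
apply: (iffP forallP) => H y.
  by have /existsP[i /forall_inP Hi] := H y; exists i.
by have [i Hi] := H y; apply/existsP; exists i; apply/forall_inP.
Qed.

Lemma dominantS t t' : t \subset t' -> dominant t' -> dominant t.
Proof.
move=> /subsetP tt' /dominantP H; apply/dominantP => y.
by have [i Hi] := H y; exists i => x /tt'; apply: Hi.
Qed.

Lemma argmin_in t (z0 : Z) : z0 \in t ->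
  exists m : I -> Z, forall l, m l \in t /\ forall x, x \in t -> rk l (m l) <= rk l x.
Proof.
move=> z0t; exists (fun l => [arg min_(x < z0 in t) rk l x]) => l.
by case: arg_minnP.
Qed.

(* [m l] is the [l]-least element of [t]. As [t] is dominant, [m] maps [I] onto
   [t], so [m i = m j] is its only collision; the elements which extend [t] to a
   dominant set are the [k]-greatest elements of [above k] for [k = i, j]. *)
Section Door.
Variables (t : {set Z}) (m : I -> Z) (i j : I).
Hypothesis t_dom : dominant t.
Hypothesis t_card : #|I| = #|t|.+1.
Hypothesis m_in : forall l, m l \in t.
Hypothesis m_min : forall l x, x \in t -> rk l (m l) <= rk l x.
Hypothesis neq_ij : i != j.
Hypothesis m_ij : m i = m j.

Definition above k : {set Z} := [set y | [forall (l | l != k), rk l (m l) < rk l y]].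

Lemma aboveP k y :
  reflect (forall l, l != k -> rk l (m l) < rk l y) (y \in above k).
Proof. by rewrite inE; apply: (iffP forall_inP). Qed.

Definition top k x := (x \in above k) && [forall y in above k, rk k y <= rk k x].

Lemma top_ex k : above k != set0 -> exists x, top k x.
Proof.
case/set0Pn=> y0 y0k; exists [arg max_(y > y0 in above k) rk k y].
by case: arg_maxnP => //= x xk xmax; rewrite /top xk; apply/forall_inP.
Qed.

Lemma top_uniq k x y : top k x -> top k y -> x = y.
Proof.
move=> /andP[xk /forall_inP xm] /andP[yk /forall_inP ym].
by apply: (@rk_inj k); apply/eqP; rewrite eqn_leq ym // xm.
Qed.

Lemma mem_min l x : (forall y, y \in t -> rk l x <= rk l y) -> x \in t -> x = m l.
Proof.
move=> xmin xt; apply: (@rk_inj l); apply/eqP.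
by rewrite eqn_leq xmin // m_min.
Qed.

(** Dominance puts [x] weakly below all of [t] in some order, and membership in [above k] rules out
    every order but [k]. *)
Lemma above_le k x : x \in above k -> forall y, y \in t -> rk k x <= rk k y.
Proof.
move=> /aboveP xk; have [l lmin] := dominantP _ t_dom x.
have [<-//|/xk] := eqVneq l k.
by rewrite ltnNge lmin.
Qed.

(** Dominance applied to [x] itself makes [x] least in some order; if that order is [k], the
    collision [m i = m j] offers another index. *)
Lemma m_surj k x : (k == i) || (k == j) -> x \in t -> exists2 l, l != k & x = m l.
Proof.
move=> kij xt; have [l /mem_min/(_ xt)->] := dominantP _ t_dom x.
have [->|lk] := eqVneq l k; last by exists l.
by case/orP: kij => /eqP->; [exists j|exists i]; rewrite ?m_ij // eq_sym.
Qed.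

(** In order [k], a [y] in [above k] is at most [x] by maximality and at most [t] by [above_le]. Any
    other [y] is at most some [m l] with [l != k], which lies below [x] in order [l]. *)
Lemma top_room k x : (k == i) || (k == j) -> top k x ->
  x \notin t /\ dominant (x |: t).
Proof.
move=> kij /andP[xk /forall_inP xmax]; have /aboveP xab := xk; split.
  apply/negP => /(m_surj kij)[l lk xl]; have := xab _ lk.
  by rewrite xl ltnn.
apply/dominantP => y.
have [yk|] := boolP (y \in above k).
  exists k => z /setU1P[->|zt]; first exact: xmax.
  exact: (above_le yk).
rewrite inE negb_forall => /existsP[l]; rewrite negb_imply -leqNgt => /andP[lk yl].
exists l => z /setU1P[->|zt]; last exact: leq_trans yl (m_min _ zt).
by apply: leq_trans yl _; apply: ltnW; apply: xab.
Qed.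

(** Let [x] be least in order [k]. The elements of [t] are then least in orders other than [k], so
    by cardinality [m] is injective off [k], and the collision must involve [k]. *)
Lemma room_top x : x \notin t -> dominant (x |: t) -> top i x || top j x.
Proof.
move=> xt /dominantP D.
have [k kx] := D x.
have surj z : z \in t -> exists l,
    [/\ l != k, z = m l & forall y, y \in x |: t -> rk l z <= rk l y].
  move=> zt; have [l lz] := D z; exists l; split=> //.
    apply/negP => /eqP lk; move: xt; rewrite -(_ : z = x) ?zt //.
    apply: (@rk_inj l); apply/eqP; rewrite eqn_leq lz ?setU11 //.
    by rewrite lk kx // setU1r.
  by apply: mem_min => // y yt; apply: lz; rewrite setU1r.
have im : m @: [set~ k] = t.
  apply/eqP; rewrite eqEsubset; apply/andP; split; apply/subsetP => z.
    by case/imsetP => l _ ->.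
  by move=> /surj[l [lk -> _]]; apply: imset_f; rewrite !inE.
have inj : {in [set~ k] &, injective m}.
  by apply/imset_injP; rewrite im cardsC1 t_card.
have kij : (k == i) || (k == j).
  apply/negPn/negP; rewrite negb_or => /andP[ki kj].
  by move/eqP: neq_ij; apply; apply: inj => //; rewrite !inE eq_sym.
suff : top k x by case/orP: kij => /eqP -> ->; rewrite ?orbT.
have xk : x \in above k.
  apply/aboveP => l lk.
  have [l' [l'k ml lmin]] := surj _ (m_in l).
  have ll' : l' = l by apply: inj; rewrite ?inE.
  rewrite ltn_neqAle -ll' -ml lmin ?setU11 // andbT.
  by apply/eqP => /rk_inj mx; move: xt; rewrite -mx m_in.
rewrite /top xk /=; apply/forall_inP => y /aboveP yk.
have [l ly] := D y; have [<-|lk] := eqVneq l k; first by rewrite ly ?setU11.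
by have := yk _ lk; rewrite ltnNge ly // setU1r.
Qed.

Lemma top_disj x : top i x -> ~~ top j x.
Proof.
move=> /andP[xi _]; apply/negP => /andP[/aboveP xj _].
by have := xj _ neq_ij; rewrite ltnNge (above_le xi).
Qed.

Lemma card_rooms :
  #|[set x | (x \notin t) && dominant (x |: t)]|
    = (above i != set0) + (above j != set0).
Proof.
have -> : [set x | (x \notin t) && dominant (x |: t)] =
    [set x | top i x] :|: [set x | top j x].
  apply/setP => x; rewrite !inE; apply/andP/idP => [[]|]; first exact: room_top.
  by case/orP; apply: top_room; rewrite eqxx ?orbT.
have card1 k : #|[set x | top k x]| = (above k != set0).
  have [above0|] := eqVneq (above k) set0.
    by apply/eqP; rewrite cards_eq0; apply/eqP/setP => x; rewrite inE /top above0 !inE.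
  case/top_ex=> x xtop; rewrite /= -(cards1 x); congr #|pred_of_set _|; apply/setP => y.
  by rewrite !inE; apply/idP/eqP => [/top_uniq/(_ xtop)|->].
rewrite cardsU !card1 (_ : _ :&: _ = set0) ?cards0 ?subn0 //.
by apply/setP => x; rewrite !inE; apply/negP => /andP[/top_disj/negP].
Qed.

End Door.

Lemma door_collision t m : #|I| = #|t|.+1 -> (forall l, m l \in t) ->
  exists i j : I, i != j /\ m i = m j.
Proof.
move=> card m_in.
have : ~~ injectiveb m.
  apply/negP => /injectiveP /card_imset e.
  have := subset_leq_card (_ : m @: I \subset t).
  rewrite e card ltnn => /(_ _)/negP; apply=> //.
  by apply/subsetP => z /imsetP[l _ ->].
by case/injectivePn => i [j ij e]; exists i, j.
Qed.


(* The slack [s i] is the least element of order [i] and lies above all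
   non-slack elements in the other orders. Doors and rooms are the dominant sets
   with [#|I|.-1] and [#|I|] elements; [outer] is the only door with an odd
   number of rooms, whereas a room that is not colorful has 0 or 2 doors. *)
Section Slacks.
Variables (s : I -> Z) (c : Z -> I) (i0 : I) (z0 : Z).
Hypothesis s_inj : injective s.
Hypothesis s_min : forall i z, rk i (s i) <= rk i z.
Hypothesis s_big : forall i j z, i != j -> z \notin codom s -> rk i z < rk i (s j).
Hypothesis c_s : cancel s c.
Hypothesis z0_s : z0 \notin codom s.
Hypothesis I_gt1 : 1 < #|I|.

Definition door t := [&& dominant t, #|I| == #|t|.+1 & c @: t == [set~ i0]].

Definition rooms t := #|[set x | (x \notin t) && dominant (x |: t)]|.

Definition outer : {set Z} := s @: [set~ i0].

Lemma s_lt i j : i != j -> rk i (s i) < rk i (s j).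
Proof.
move=> ij; rewrite ltn_neqAle s_min andbT.
by apply/eqP => /rk_inj/s_inj e; rewrite e eqxx in ij.
Qed.

(** For [t != outer], the slack [s k] lies in [above m k] for every [k], which gives two rooms. For
    [outer], the collision pairs [i0] with some [j]; [above m i0] contains [z0], and [above m j] is
    empty. *)
Lemma odd_rooms t : door t -> odd (rooms t) = (t == outer).
Proof.
case/and3P=> tdom /eqP tcard /eqP tcol.
have [z1 z1t] : exists z, z \in t.
  by apply/set0Pn; rewrite -card_gt0 -ltnS -tcard.
have [m mP] := argmin_in z1t.
have m_in l : m l \in t by case: (mP l).
have m_min l x : x \in t -> rk l (m l) <= rk l x by case: (mP l) => _; apply.
have [i [j [ij mij]]] := door_collision tcard m_in.
rewrite /rooms (card_rooms tdom tcard m_in m_min ij mij).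
have [tE|tN] := eqVneq t outer; last first.
  suff ne k : above m k != set0 by rewrite !ne.
  (* A door made of slacks only is determined by its colors, hence equal to [outer]. *)
  have [z zt zs] : exists2 z, z \in t & z \notin codom s.
    case: (pickP [pred z | (z \in t) && (z \notin codom s)]) => [z /andP[]|none].
      by exists z.
    have sub x : x \in t -> x \in codom s.
      by move=> xt; have := none x; rewrite /= xt => /negbFE.
    case/eqP: tN; rewrite /outer -tcol -imset_comp.
    apply/setP => x; apply/idP/imsetP => [xt|[y yt ->]].
      exists x => //=; have /codomP[l ->] := sub _ xt.
      by rewrite c_s.
    by have /codomP[l el] := sub _ yt; rewrite /= el c_s -el.
  apply/set0Pn; exists (s k); apply/aboveP => l lk.
  have [/codomP[k' mk']|/s_big] := boolP (m l \in codom s); last exact.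
  have [lk'|lk'] := eqVneq l k'; first by rewrite mk' -lk' s_lt.
  by have := m_min l _ zt; rewrite mk' leqNgt s_big.
have ml l : l != i0 -> m l = s l.
  move=> li; apply: (@rk_inj l); apply/eqP; rewrite eqn_leq s_min andbT m_min //.
  by rewrite tE imset_f // !inE.
suff main : forall i j, i != j -> m i = m j -> i = i0 ->
    odd ((above m i != set0) + (above m j != set0)).
  have [/main->//|ni] := eqVneq i i0.
  have [ej|nj] := eqVneq j i0; first by rewrite addnC main // eq_sym.
  by move: mij; rewrite !ml // => /s_inj /eqP; rewrite (negPf ij).
clear i j ij mij; move=> i j + + ii0; rewrite ii0 eq_sym => ji0 mj.
have -> : above m i0 != set0.
  apply/set0Pn; exists z0; apply/aboveP => l li0.
  rewrite ml // ltn_neqAle s_min andbT; apply/eqP => /rk_inj e.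
  by have := z0_s; rewrite -e codom_f.
(* In order [i0], such a [y] would exceed [s j], hence be a slack [s l]; each [l] is then
   excluded. *)
suff -> : above m j = set0 by rewrite eqxx.
apply/setP => y; rewrite in_set0; apply/negP => /aboveP yj.
have yi0 := yj i0; rewrite eq_sym mj ml // in yi0.
have [/codomP[l yl]|] := boolP (y \in codom s); last first.
  by move=> ys; have := yi0 ji0; rewrite ltnNge ltnW // s_big // eq_sym.
have [li0|li0] := eqVneq l i0.
  by have := yi0 ji0; rewrite yl li0 ltnNge s_min.
have [lj|lj] := eqVneq l j; first by have := yi0 ji0; rewrite yl lj ltnn.
by have := yj _ lj; rewrite ml // yl ltnn.
Qed.

Lemma door_outer : door outer.
Proof.
have card_outer : #|outer| = #|I|.-1 by rewrite card_imset // cardsC1.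
apply/and3P; split.
- apply/dominantP => y; have [/codomP[i ->]|ys] := boolP (y \in codom s).
    by exists i => x _; apply: s_min.
  exists i0 => x /imsetP[l]; rewrite !inE eq_sym => li0 ->.
  by rewrite ltnW // s_big.
- by rewrite card_outer prednK // ltnW.
- rewrite -imset_comp; apply/eqP/setP => l; apply/imsetP/idP => [[k ki0 ->]|li0].
    by rewrite /= c_s.
  by exists l; rewrite //= c_s.
Qed.

Definition doors (u : {set Z}) := #|[set x | (x \in u) && door (u :\ x)]|.

(** Double counting of the pairs of a door and a room that extends it by one element [x]. *)
Lemma sum_rooms_doors :
  \sum_(t | door t) rooms t = \sum_(u | dominant u) doors u.
Proof.
have -> : \sum_(t | door t) rooms t =
    \sum_(t | door t) \sum_(x | (x \notin t) && dominant (x |: t)) 1.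
  apply: eq_bigr => t _; rewrite /rooms /doors -sum1_card.
  by apply: eq_bigl => x; rewrite inE.
have -> : \sum_(u | dominant u) doors u =
    \sum_(u | dominant u) \sum_(x | (x \in u) && door (u :\ x)) 1.
  apply: eq_bigr => t _; rewrite /rooms /doors -sum1_card.
  by apply: eq_bigl => x; rewrite inE.
rewrite (exchange_big_dep predT) //= [RHS](exchange_big_dep predT) //=.
apply: eq_bigr => x _.
rewrite (reindex_onto (fun u => u :\ x) (fun t => x |: t)) /=; last first.
  by move=> t /and3P[_ xt _]; rewrite setU1K.
apply: eq_bigl => u; rewrite !inE eqxx /=.
have [xu|xu] := boolP (x \in u); first by rewrite setD1K // eqxx andbT andbC.
rewrite andbF; apply/negP => /andP[_ /eqP e]; move: xu; rewrite -e setU11.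
by [].
Qed.

(** If [u :\ x0] is a door, then, [u] not being colorful, [x0] shares its color with exactly one
    other element [x1] of [u]. The doors of [u] arise by removing one of these twins. *)
Lemma odd_doors (u : {set Z}) : dominant u -> c @: u != [set: I] -> ~~ odd (doors u).
Proof.
move=> udom ucol; rewrite /doors; set D := [set x | _].
have [->|/set0Pn[x0]] := eqVneq D set0; first by rewrite cards0.
have DE x : (x \in D) = (x \in u) && door (u :\ x) by rewrite inE.
rewrite DE => /andP[x0u /and3P[_ /eqP card0 /eqP col0]].
have inj x : x \in D -> {in u :\ x &, injective c}.
  rewrite DE => /andP[_ /and3P[_ /eqP card /eqP col]].
  by apply/imset_injP; rewrite col cardsC1 card.
have cx0 : c x0 != i0.
  apply: contraNneq ucol => cx0; rewrite -(setD1K x0u) imsetU1 col0 cx0.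
  by apply/eqP/setP => i; rewrite !inE orbN.
have : c x0 \in c @: (u :\ x0) by rewrite col0 !inE.
case/imsetP=> x1; rewrite !inE => /andP[x10 x1u] c01.
have sub a b : a \in u -> c a = c b -> b \in u -> a != b ->
    c @: (u :\ b) \subset c @: (u :\ a).
  move=> au cab bu ab; apply/subsetP => _ /imsetP[z zb ->]; move: zb.
  rewrite !inE => /andP[zb zu].
  have [->|za] := eqVneq z a; last by rewrite imset_f // !inE za.
  by rewrite cab imset_f // !inE eq_sym ab.
have dom x : dominant (u :\ x) by apply: dominantS udom; apply: subD1set.
have DE2 : D = [set x0; x1].
  apply/setP => x; rewrite !in_set2; apply/idP/idP => [xD|].
    apply/negPn/negP; rewrite negb_or => /andP[xx0 xx1].
    move/eqP: x10; apply; apply/esym/(inj x) => //.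
      by rewrite !inE x0u andbT eq_sym.
    by rewrite !inE x1u andbT eq_sym.
  rewrite DE /door dom; case/orP => /eqP ->; first by rewrite x0u card0 col0 !eqxx.
  rewrite x1u /= (_ : c @: (u :\ x1) = c @: (u :\ x0)).
    rewrite col0 card0; have := cardsD1 x0 u.
    by rewrite (cardsD1 x1 u) x0u x1u !add1n => -[->]; rewrite !eqxx.
  by apply/eqP; rewrite eqEsubset !sub // eq_sym.
by rewrite DE2 cards2 eq_sym x10.
Qed.

(** Without a colorful room, the number of door-room pairs would be odd when counted by doors,
    because of [outer] alone, and even when counted by rooms. *)
Lemma colorful_room : exists t, dominant t /\ c @: t = [set: I].
Proof.
have [t /andP[td /eqP tI]|none] := pickP [pred t | dominant t && (c @: t == [set: I])].
  by exists t.
have : odd (\sum_(t | door t) rooms t).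
  rewrite (bigD1 outer) ?door_outer //= oddD odd_rooms ?door_outer // eqxx addTb.
  elim/big_ind: _ => [|x y|t /andP[td /negPf tN]] //.
    by rewrite oddD; do 2!case: odd.
  by rewrite odd_rooms ?tN.
rewrite sum_rooms_doors => /negP; case.
elim/big_ind: _ => [|x y|u ud]; rewrite ?oddD //; first by do 2!case: odd.
by apply/negP; apply: odd_doors => //; have := none u; rewrite /= ud => /negbT.
Qed.

End Slacks.

End Dominance.

(** * Scarf's lemma for natural weights with ties *)

Section Scarf.
Variables (I X : finType) (w : I -> X -> nat) (c : X -> I).

(* [enum_rank] breaks the ties of [w i]. *)
Let rk0 i x := (w i x * #|X| + enum_rank x).+1.
Let big i := (\max_x rk0 i x).+1.
(** The slacks are the [inr j]. The successor in [rk0] reserves rank 0 for the slack of order [i]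
    itself. *)
Let rk (i : I) (z : X + I) : nat :=
  match z with
  | inl x => rk0 i x
  | inr j => if i == j then 0 else big i + enum_rank j
  end.

Let rk0_big i x : rk0 i x < big i.
Proof. by rewrite ltnS; apply: (leq_bigmax x). Qed.

Let rk_inj i : injective (rk i).
Proof.
have rk0_inj : injective (rk0 i).
  move=> x y [] e; apply/enum_rank_inj/val_inj => /=.
  have := congr1 (modn^~ #|X|) e.
  by rewrite !modnMDl !modn_small.
have neq x j : rk i (inl x) <> rk i (inr j).
  rewrite /=; case: ifP => // _ e.
  by have := rk0_big i x; rewrite e ltnNge leq_addr.
move=> [x|j] [y|k] e.
- by congr inl; apply: rk0_inj.
- by case: (neq _ _ e).
- by case: (neq _ _ (esym e)).
- congr inr; move: e => /=.
  case: (eqVneq i j) => [<-|_]; case: (eqVneq i k) => [<-|_] //.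
  by move=> /addnI e; apply/enum_rank_inj/val_inj.
Qed.

Let rk0_le i x y : rk0 i x <= rk0 i y -> w i x <= w i y.
Proof.
rewrite ltnS => e; have K_gt0 : 0 < #|X| by apply/card_gt0P; exists x.
rewrite -ltnS -(ltn_pmul2r K_gt0) mulSnr.
apply: leq_ltn_trans (leq_addr (enum_rank x) _) _.
by apply: leq_ltn_trans e _; rewrite ltn_add2l ltn_ord.
Qed.

Lemma scarf (x0 : X) : exists (t : {set X}) (C : {set I}),
  c @: t = C /\ forall y, exists2 i, i \in C & forall x, x \in t -> w i y <= w i x.
Proof.
have [I_le1|I_gt1] := leqP #|I| 1.
  pose x1 := [arg max_(x > x0) w (c x0) x].
  exists [set x1], [set c x1]; split; first by rewrite imset_set1.
  move=> y; exists (c x1); rewrite ?inE // => x /set1P ->.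
  have /fintype_le1P/(_ (c x0)) c1 := I_le1.
  by rewrite (c1 (c x1)) /x1; case: arg_maxnP => // z _; apply.
pose cz (z : X + I) := match z with inl x => c x | inr j => j end.
have x0s : inl x0 \notin codom (@inr X I) by apply/negP => /codomP[].
have [] // := @colorful_room I _ rk rk_inj (@inr X I) cz (c x0) (inl x0)
  _ _ _ _ x0s I_gt1.
- by move=> i j [].
- by move=> i z /=; rewrite eqxx.
- move=> i j [x|k] /negPf ij; last by rewrite codom_f.
  by rewrite /= ij => _; apply: leq_trans (rk0_big i x) (leq_addr _ _).
move=> t [/dominantP tdom tI].
exists [set x | inl x \in t], [set c x | x in [set x | inl x \in t]]; split=> // y.
have [i imin] := tdom (inl y); exists i; last first.
  by move=> x; rewrite inE => /imin/rk0_le.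
(* The color [i] is carried by a genuine point: the slack [inr i] has rank 0 in order [i], below
   [inl y]. *)
have : i \in cz @: t by rewrite tI.
case/imsetP=> -[x|j] zt /= iE; first by rewrite iE imset_f // inE.
by have := imin _ zt; rewrite /= iE eqxx.
Qed.

End Scarf.


(** * Grids of the simplex, kept as integer numerators over [N] *)

Definition grid (n N : nat) : finType :=
  {x : {ffun 'I_n -> 'I_N.+1} | \sum_i x i == N}.

Definition gcoord n N (x : grid n N) (i : 'I_n) : nat := val x i.

Lemma sum_gcoord n N (x : grid n N) : \sum_i gcoord x i = N.
Proof. exact/eqP/(valP x). Qed.

Lemma grid_mk n N (f : 'I_n -> nat) : \sum_i f i = N ->
  exists x : grid n N, forall i, gcoord x i = f i.
Proof.
move=> fN; have f_le i : f i < N.+1.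
  by rewrite ltnS -fN (bigD1 i) //= leq_addr.
pose g := [ffun i => Ordinal (f_le i)].
have gN : \sum_i g i == N.
  by rewrite -[X in _ == X]fN; apply/eqP/eq_bigr => i _; rewrite ffunE.
by exists (exist _ g gN) => i; rewrite /gcoord /= ffunE.
Qed.

(** In Scarf's set [t], the coordinatewise minima over the colors [C] already sum to at least
    [N - n]. So every point of [t] exceeds the vector of these minima, extended by 0 off [C], by at
    most [n] in total, and any [x0] in [t] will do. *)
Lemma grid_scarf n N (c : grid n.+1 N -> 'I_n.+1) : exists x0 : grid n.+1 N,
  forall k, gcoord x0 k <= n \/ exists2 y, c y = k &
    forall i, gcoord y i <= gcoord x0 i + n /\ gcoord x0 i <= gcoord y i + n.
Proof.
have [z0 _] : exists x : grid n.+1 N, forall i, gcoord x i = if i == ord0 then N else 0.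
  by apply: grid_mk; rewrite -big_mkcond big_pred1_eq.
have [t [C [cC dom]]] := scarf (fun i (x : grid n.+1 N) => gcoord x i) c z0.
have [i1 i1C _] := dom z0.
have [x0 x0t _] : exists2 x, x \in t & i1 = c x by apply/imsetP; rewrite cC.
pose m i := gcoord [arg min_(x < x0 in t) gcoord x i] i.
have mE i : exists2 x, x \in t & m i = gcoord x i.
  by rewrite /m; case: arg_minnP => // x; exists x.
have m_le i x : x \in t -> m i <= gcoord x i.
  by rewrite /m; case: arg_minnP => // z _; apply.
clearbody m.
have summ : N <= \sum_(i in C) m i + n.
  rewrite leqNgt; apply/negP => lt_N.
  have le_N : \sum_(i in C) (m i).+1 <= N.
    have -> : \sum_(i in C) (m i).+1 = \sum_(i in C) m i + #|C|.
      by rewrite -sum1_card -big_split /=; apply: eq_bigr => i _; rewrite addn1.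
    by apply: leq_trans lt_N; rewrite -addnS leq_add2l -[leqRHS]card_ord max_card.
  (* This grid point exceeds [m] in all coordinates of [C], against dominance. *)
  pose f i := (if i \in C then (m i).+1 else 0) +
    (if i == i1 then N - \sum_(i in C) (m i).+1 else 0).
  have [|y yE] := @grid_mk n.+1 N f.
    by rewrite big_split /= -!big_mkcond big_pred1_eq subnKC.
  have [i iC yi] := dom y; have [x xt mx] := mE i.
  by have := yi _ xt; rewrite -mx yE /f iC leqNgt leq_addr.
have bound x : x \in t ->
    \sum_(i in C) (gcoord x i - m i) + \sum_(i | i \notin C) gcoord x i <= n.
  move=> xt; rewrite sumnB; last by move=> i _; apply: m_le.
  have := sum_gcoord x; rewrite (bigID (fun i => i \in C)) /=.
  have : \sum_(i in C) m i <= \sum_(i in C) gcoord x i.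
    by apply: leq_sum => i _; apply: m_le.
  by move=> le_m e; rewrite addnBAC // e leq_subLR.
have inC x i : x \in t -> i \in C -> gcoord x i <= m i + n.
  move=> xt iC; have := bound _ xt; rewrite (bigD1 i) //=.
  lia.
have outC x i : x \in t -> i \notin C -> gcoord x i <= n.
  move=> xt iC; have := bound _ xt; rewrite [X in _ + X](bigD1 i) //=.
  lia.
exists x0 => k; have [|kC] := boolP (k \in C); last by left; apply: outC.
rewrite -cC => /imsetP[y yt kE]; right; exists y => // i.
have [iC|iC] := boolP (i \in C).
  have := inC _ _ x0t iC; have := inC _ _ yt iC.
  by have := m_le i _ x0t; have := m_le i _ yt; lia.
have := outC _ _ x0t iC; have := outC _ _ yt iC; lia.
Qed.

From mathcomp Require Import all_boot all_order all_algebra.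
From mathcomp Require Import all_classical all_reals all_analysis.
From mathcomp Require Import finmap lra.
Import Order.TTheory GRing.Theory Num.Theory.
Import numFieldNormedType.Exports.

Local Open Scope classical_set_scope.
Local Open Scope ring_scope.

(** * Continuity of matrix-valued maps and finite sums *)

Lemma continuous_mx (T U : topologicalType) m n (f : T -> 'M[U]_(m, n)) :
  (forall i j, continuous (fun x => f x i j)) -> continuous f.
Proof.
move=> fc x B [P xP PB]; rewrite /nbhs /= /nbhs /=.
have : \forall y \near x, forall i j, P i j (f y i j).
  apply: filter_forall => i; apply: filter_forall => j.
  exact: (fc i j x _ (xP i j)).
by apply: filterS => y Py; apply: PB.
Qed.

Lemma continuous_entry (U : topologicalType) m n i j :
  continuous (fun M : 'M[U]_(m, n) => M i j).
Proof.
move=> A B AB; exists (fun i' j' => if (i' == i) && (j' == j) then B else setT).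
  by move=> i' j'; case: ifP => [/andP[/eqP-> /eqP->]//|_]; exact: filterT.
by move=> M /(_ i j); rewrite !eqxx.
Qed.

Lemma continuous_sum (K : numFieldType) (V : normedModType K)
    (T : topologicalType) (I : Type) (r : seq I) (f : I -> T -> V) :
  (forall i, continuous (f i)) -> continuous (fun x => \sum_(i <- r) f i x).
Proof.
by move=> fc; apply: (@continuous_big V I +%R 0 predT (@add_continuous V)).
Qed.

(** * Compactness of the simplex and the covering theorem *)

Section Simplex.
Context {R : realType}.

Lemma simplex_le1 n (q : 'rV[R]_n) i : simplex q -> q 0 i <= 1.
Proof.
by move=> [q0 <-]; rewrite (bigD1 i) //= lerDl sumr_ge0.
Qed.

Lemma closed_simplex n : closed (@simplex R n).
Proof.
have -> : @simplex R n = (\bigcap_j [set q : 'rV[R]_n | 0 <= q 0 j]) `&`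
    [set q | \sum_j q 0 j = 1].
  apply/seteqP; split => q [q0 q1]; split=> // j; first by move=> _; exact: q0.
  exact: (q0 j I).
apply: closedI.
  apply: closed_bigI => j _.
  exact: (@preimage_closed _ _ (fun q : 'rV[R]_n => q 0 j) [set x | 0 <= x]
    (in1W (@continuous_entry R 1 n 0 j)) (@closed_ge R 0)).
apply: (@preimage_closed _ _ (fun q : 'rV[R]_n => \sum_j q 0 j) [set x | x = 1] _
  (@closed_eq R 1)).
by apply: in1W; apply: continuous_sum => j; exact: continuous_entry.
Qed.

Lemma compact_simplex n : compact (@simplex R n).
Proof.
have /= := @rV_compact R n (fun=> `[0, 1]%classic) (fun=> @segment_compact R 0 1).
move/(subclosed_compact (@closed_simplex n)); apply.
by move=> q qs i /=; rewrite in_itv /= simplex_le1 // (qs.1 i).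
Qed.

(** Viewed as vectors of rows, stochastic matrices form a product of simplices, which is compact;
    [f] flattens it continuously. *)
Lemma compact_stochastic d : compact (@stochastic R d).
Proof.
pose f (v : 'rV['rV[R]_d]_d) : 'M[R]_d := \matrix_(i, j) v 0 i 0 j.
have -> : @stochastic R d = f @` [set v : 'rV['rV[R]_d]_d | forall i, simplex (v 0 i)].
  apply/seteqP; split=> [P Ps|_ [v vs <-] i].
    exists (\row_i row i P) => [i|] /=; first by rewrite mxE.
    by apply/matrixP => i j; rewrite !mxE.
  by rewrite (_ : row i (f v) = v 0 i) //; apply/rowP => j; rewrite !mxE.
apply: continuous_compact; last first.
  exact: (@rV_compact 'rV[R]_d d (fun=> simplex) (fun=> @compact_simplex d)).
apply: continuous_subspaceT; apply: continuous_mx => i j.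
rewrite (_ : (fun v => f v i j) = (fun q : 'rV[R]_d => q 0 j) \o
    (fun v : 'rV['rV[R]_d]_d => v 0 i)).
  by move=> v; apply: continuous_comp; exact: continuous_entry.
by apply/funext => v /=; rewrite mxE.
Qed.

Definition gridpoint n N (x : grid n N) : 'rV[R]_n := \row_i ((gcoord x i)%:R / N%:R).

Lemma gridpoint_simplex n N (x : grid n N) : (0 < N)%N -> simplex (gridpoint x).
Proof.
move=> N0; split=> [j|]; first by rewrite mxE divr_ge0.
under eq_bigr do rewrite mxE.
by rewrite -mulr_suml -natr_sum sum_gcoord divff // pnatr_eq0 -lt0n.
Qed.

(** Each grid point is colored by some [F k] that contains it. [grid_scarf] yields points [u N]
    which, for each [k], have a small coordinate [k] or a point of [F k] nearby; a cluster point of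
    [u] is common to all [F k]. *)
Lemma dual_kkm n (F : 'I_n.+1 -> set 'rV[R]_n.+1) :
  (forall k, closed (F k)) ->
  (forall k q, simplex q -> q 0 k = 0 -> F k q) ->
  (forall q, simplex q -> exists k, F k q) ->
  exists2 q, simplex q & forall k, F k q.
Proof.
move=> Fcl Fface Fcov.
have step (N : nat) : exists u : 'rV[R]_n.+1, simplex u /\ forall k,
    u 0 k <= n%:R / N.+1%:R \/
    exists2 v, F k v & forall i, `|u 0 i - v 0 i| <= n%:R / N.+1%:R.
  have /choice[c cP] : forall x : grid n.+1 N.+1, exists k, F k (gridpoint x).
    by move=> x; apply/Fcov/gridpoint_simplex.
  have [x0 x0P] := grid_scarf c; exists (gridpoint x0).
  split=> [|k]; first exact: gridpoint_simplex.
  have [k_le|[y <- yP]] := x0P k; [left|right].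
    by rewrite mxE ler_pM2r ?invr_gt0 ?ltr0n // ler_nat.
  exists (gridpoint y) => // i; have [y_le x_le] := yP i.
  rewrite !mxE -mulrBl normrM [X in _ * X]ger0_norm ?invr_ge0 //.
  rewrite ler_pM2r ?invr_gt0 ?ltr0n //.
  by move: y_le x_le; rewrite -!(ler_nat R) !natrD ler_norml; lra.
have /choice[u uP] := step.
have [p [ps pu]] : simplex `&` cluster (u @ \oo) !=set0.
  apply: compact_simplex; exists 0%N => // N _; exact: (uP N).1.
exists p => // k; have [pk0|pk] := eqVneq (p 0 k) 0; first exact: Fface.
have {}pk : 0 < p 0 k by rewrite lt_neqAle eq_sym pk (ps.1 k).
rewrite (closure_id (F k)).1 // => B /nbhs_ballP[e /= e0 eB].
(* The distance from [u N] to [p] and the mesh bound will both be below [e']. Their sum stays below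
   [e], and below [p 0 k], which excludes a small coordinate [k] of [u N]. *)
pose e' := Num.min e (p 0 k) / 2.
have e'0 : 0 < e' by rewrite divr_gt0 // lt_min e0.
have [M _ MP] : \forall N \near \oo, n%:R / N.+1%:R < e'.
  near=> N; rewrite ltr_pdivrMr ?ltr0n // mulrC -ltr_pdivrMr //.
  by apply: lt_trans (_ : N%:R < _); [near: N; exact: nbhs_infty_gtr|rewrite ltr_nat].
have [_ [[N /= MN <-] [_ pN]]] : (u @` [set N | (M <= N)%N] `&` ball p e') !=set0.
  apply: pu; last exact: nbhsx_ballx.
  by exists M => // N MN; exists N.
have {}MN : n%:R / N.+1%:R < e' := MP _ MN.
have e'e : e' + e' <= e by rewrite -splitr ge_min lexx.
have e'p : e' + e' <= p 0 k by rewrite -splitr ge_min lexx orbT.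
have [uk|[v Fv uv]] := (uP N).2 k.
  have := le_lt_trans uk MN; have := pN 0 k; rewrite /ball /= ltr_norml => ? ?.
  by exfalso; lra.
exists v; split=> //; apply: eB; split=> // i j.
rewrite ord1; have := pN 0 j; have := le_lt_trans (uv j) MN.
rewrite /ball /= !ltr_norml; lra.
Unshelve. all: by end_near.
Qed.

End Simplex.

(** * Jensen's inequality and Ky Fan's inequality *)

Local Open Scope convex_scope.

Lemma within_continuous_comp_in (T U W : topologicalType) (A : set T) (B : set U)
    (f : T -> U) (g : U -> W) :
  {within A, continuous f} -> (forall x, A x -> B (f x)) ->
  {within B, continuous g} -> {within A, continuous (g \o f)}.
Proof.
move=> /subspace_continuousP fc fAB /subspace_continuousP gc.
apply/subspace_continuousP => x Ax.
apply: (@cvg_comp _ _ _ f g _ (within B (nbhs (f x)))).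
  move=> C /(fc _ Ax); rewrite /= /nbhs /= /within /=.
  by apply: filterS => y /[swap] Ay /(_ Ay); apply; exact: fAB.
exact/gc/fAB.
Qed.

(** Induction on [n], splitting off the first weight [a] and dividing the others by [1 - a].
    Membership in [D] is carried along because [f] is convex on [D] only. *)
Lemma jensen (R : realFieldType) (E : lmodType R) (D : set (convex_lmodType E))
    (f : E -> R) n (l : 'I_n -> R) (Q : 'I_n -> E) :
  convex_set D -> convex_function D f ->
  (forall k, 0 <= l k) -> \sum_k l k = 1 -> (forall k, D (Q k)) ->
  D (\sum_k l k *: Q k) /\ f (\sum_k l k *: Q k) <= \sum_k l k * f (Q k).
Proof.
move=> Dconv fconv; elim: n l Q => [|n IH] l Q l0 l1 DQ.
  by move: l1; rewrite big_ord0 => /esym/eqP; rewrite oner_eq0.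
move: l1; rewrite !big_ord_recl; set a := l ord0 => l1.
(* For [a = 1] no rescaling is possible, but all other weights vanish. *)
have [a1|a1] := eqVneq a 1.
  have lz k : l (lift ord0 k) = 0.
    move: l1; rewrite a1 -[RHS]addr0 => /addrI lz.
    exact: (psumr_eq0P (fun i _ => l0 (lift ord0 i)) lz).
  rewrite !big1 ?addr0 ?a1 ?scale1r ?mul1r; first by split.
  - by move=> k _; rewrite lz mul0r.
  - by move=> k _; rewrite lz scale0r.
have s_ge0 : 0 <= \sum_(k < n) l (lift ord0 k) by apply: sumr_ge0.
have a_ge0 : 0 <= a := l0 _.
have a_le1 : a <= 1 by rewrite -l1 lerDl.
have b_gt0 : 0 < 1 - a by rewrite subr_gt0 lt_neqAle a1.
pose l' k := l (lift ord0 k) / (1 - a).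
have [||//|DS fS] := IH l' (fun k => Q (lift ord0 k)).
- by move=> k; rewrite divr_ge0 // ltW.
- rewrite -mulr_suml -l1 addrC addKr divff //.
  by move: b_gt0; rewrite -l1 addrC addKr => /lt0r_neq0.
set S := \sum_k _ in DS fS.
have eS : \sum_(k < n) l (lift ord0 k) *: Q (lift ord0 k) = (1 - a) *: S.
  rewrite scaler_sumr; apply: eq_bigr => k _.
  by rewrite scalerA mulrCA divff ?mulr1 // gt_eqF.
pose t := Itv01 a_ge0 a_le1.
have -> : l ord0 *: Q ord0 + \sum_(k < n) l (lift ord0 k) *: Q (lift ord0 k) =
    (Q ord0 : convex_lmodType E) <| t |> S by rewrite eS.
have DQ0 : Q ord0 \in D by apply: mem_set.
have DS' : S \in D by apply: mem_set.
split; first exact/set_mem/(Dconv _ _ t).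
apply: le_trans (fconv t _ _ DQ0 DS') _.
rewrite convRE /= lerD2l.
have -> : \sum_(k < n) l (lift ord0 k) * f (Q (lift ord0 k)) =
    (1 - a) * \sum_k l' k * f (Q (lift ord0 k)).
  rewrite mulr_sumr; apply: eq_bigr => k _.
  by rewrite mulrA mulrCA divff ?mulr1 // gt_eqF.
by rewrite ler_pM2l.
Qed.

Section KyFan.
Variables (R : realType) (V : normedModType R) (K : set (convex_lmodType V)).
Variable psi : V -> V -> R.
Hypothesis K_convex : convex_set K.
Hypothesis psi_continuous :
  forall Q, K Q -> {within (K : set V), continuous (fun P => psi P Q)}.
Hypothesis psi_convex : forall P, K P -> convex_function K (psi P).
Hypothesis psi_ge0 : forall P, K P -> 0 <= psi P P.

(** At a common point [l] of the sets [F k], one negative [psi (P l) (Q k)] would make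
    [psi (P l) (Q j)] negative for all [j] with [0 < l 0 j]; Jensen's inequality at [P l] then
    contradicts [psi_ge0]. *)
Lemma ky_fan_finite n (Q : 'I_n.+1 -> V) : (forall k, K (Q k)) ->
  exists2 P, K P & forall k, 0 <= psi P (Q k).
Proof.
move=> KQ.
pose P (l : 'rV[R]_n.+1) := \sum_k l 0 k *: Q k.
have Pjensen l : simplex l ->
    K (P l) /\ forall A, K A -> psi A (P l) <= \sum_k l 0 k * psi A (Q k).
  move=> [l0 l1]; split=> [|A KA].
    exact: (jensen K_convex (psi_convex (KQ ord0)) l0 l1 KQ).1.
  exact: (jensen K_convex (psi_convex KA) l0 l1 KQ).2.
(* Brouwer's theorem would be applied to [l |-> (l + g l) / (1 + \sum_j g j l)];
   [F k] is the set where this map does not decrease the coordinate [k]. *)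
pose g k l := Num.max 0 (- psi (P l) (Q k)).
pose h k l := g k l - l 0 k * \sum_j g j l.
pose F k := simplex `&` [set l | 0 <= h k l].
have g_ge0 k l : 0 <= g k l by rewrite /g le_max lexx.
have Pcont : continuous P.
  apply: continuous_sum => k l.
  by apply: continuousZ; [exact: continuous_entry|exact: cst_continuous].
have gcont k : {within simplex, continuous (g k)}.
  have pcont : {within simplex, continuous (fun l => psi (P l) (Q k))}.
    apply: (within_continuous_comp_in (B := (K : set V))
      (continuous_subspaceT Pcont) _ (psi_continuous (KQ k))).
    by move=> l /Pjensen[].
  move=> l; apply: (@continuous_max R (subspace simplex) (fun=> 0)
    (fun l => - psi (P l) (Q k)) l).
    exact: cst_continuous.
  apply: (@continuousN _ _ (subspace simplex) (fun l => psi (P l) (Q k))).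
  exact: pcont.
have hcont k : {within simplex, continuous (h k)}.
  move=> l; apply: continuousB; first exact: gcont.
  apply: continuousM; first by apply: continuous_subspaceT; exact: continuous_entry.
  by apply: (@continuous_sum R R (subspace simplex)) => j; exact: gcont.
have [k|k l ls lk|l ls|l ls lF] := @dual_kkm R n F.
- rewrite /F closed_setSI; last exact: closed_simplex.
  apply: (@preimage_closed (subspace simplex) R (h k) [set x | 0 <= x]).
    by move=> l _; exact: hcont.
  exact: closed_ge.
- by split=> //=; rewrite /h lk mul0r subr0.
(* If every [h k l] were negative, summing over [k] with weights of total 1 would put [\sum_j g j l]
   strictly below itself. *)
- apply: contrapT => /forallNP nF.
  have lt_g k : g k l < l 0 k * \sum_j g j l.
    by rewrite ltNge -subr_ge0; apply/negP => hk; apply: (nF k).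
  have : \sum_k g k l < \sum_k l 0 k * \sum_j g j l.
    by apply: ltr_sum => //; apply/hasP; exists ord0; rewrite ?mem_index_enum.
  by rewrite -mulr_suml ls.2 mul1r ltxx.
exists (P l) => [|k]; first by have [] := Pjensen _ ls.
have [KP le_psi] := Pjensen _ ls.
rewrite leNgt; apply/negP => psi_lt0.
have S_gt0 : 0 < \sum_j g j l.
  rewrite (bigD1 k) //=; apply: ltr_pwDl; last by apply: sumr_ge0 => j _; exact: g_ge0.
  by rewrite lt_max oppr_gt0 psi_lt0 orbT.
have term_lt0 j : 0 < l 0 j -> psi (P l) (Q j) < 0.
  move=> lj; have [_ /= hj] := lF j.
  have : 0 < g j l.
    apply: lt_le_trans (_ : 0 < l 0 j * \sum_j g j l) _; first by rewrite mulr_gt0.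
    by rewrite -subr_ge0.
  by rewrite /g lt_max ltxx oppr_gt0.
have [j /andP[_ lj]] : exists j, true && (0 < l 0 j).
  by apply: psumr_neq0P => [i _|]; [exact: ls.1|rewrite ls.2; exact/eqP/oner_neq0].
have := le_trans (psi_ge0 KP) (le_psi _ KP).
rewrite leNgt (bigD1 j) //= => /negP; apply.
rewrite -[ltRHS]addr0 ltr_leD ?pmulr_rlt0 ?term_lt0 // sumr_le0 // => i _.
have [->|li] := eqVneq (l 0 i) 0; first by rewrite mul0r.
have {}li : 0 < l 0 i by rewrite lt_neqAle eq_sym li (ls.1 i).
by rewrite ltW // pmulr_rlt0 // term_lt0.
Qed.

(** The finite intersection property in [K] for the closed sets [f Q]; [ky_fan_finite] shows that
    finitely many of them meet. *)
Lemma ky_fan : compact (K : set V) -> K !=set0 ->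
  exists2 P, K P & forall Q, K Q -> 0 <= psi P Q.
Proof.
move=> Kcompact [P0 KP0].
have Kclosed : closed (K : set V) by apply: compact_closed => //; exact: norm_hausdorff.
pose f Q : set V := (K : set V) `&` [set P | 0 <= psi P Q].
have := Kcompact; rewrite compact_In0 => /(_ V K f) [].
- exists f => [Q KQ|Q KQ]; last by rewrite setIA setIid.
  rewrite closed_setSI //.
  apply: (@preimage_closed (subspace (K : set V)) R (fun P => psi P Q)
    [set x | 0 <= x]).
    by move=> P _; exact: psi_continuous.
  exact: closed_ge.
- move=> D DK; have [->|] := eqVneq D fset0; first by exists P0.
  move=> D0; pose s := enum_fset D; have sE : size s = (size s).-1.+1.
    rewrite prednK // lt0n size_eq0; apply: contra_neq D0 => s0.
    by apply/fsetP => x; rewrite inE -[LHS]/(x \in s) s0.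
  have [|P KP PP] := @ky_fan_finite (size s).-1 (fun k => nth 0 s k).
    move=> k; have /DK : nth 0 s k \in D by apply: mem_nth; rewrite [ltnRHS]sE.
    exact: set_mem.
  exists P => Q /= QD; split=> //=.
  have Qs : (index Q s < (size s).-1.+1)%N by rewrite -sE index_mem.
  by have := PP (Ordinal Qs); rewrite /= nth_index.
- by move=> P PP; exists P => [|Q KQ]; [have [] := PP _ KP0|have [] := PP _ KQ].
Qed.
End KyFan.

(** * Stochastic matrices and the existence of Nash minimizers *)

Section Stochastic.
Context {R : realType} {d : nat}.
Implicit Types (P Q : 'M[R]_d) (q : 'rV[R]_d).

Lemma simplex_delta (i : 'I_d) : simplex (delta_mx 0 i : 'rV[R]_d).
Proof.
split=> [j|]; first by rewrite mxE ler0n.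
rewrite (bigD1 i) //= big1 ?addr0 ?mxE ?eqxx // => j /negPf ji.
by rewrite mxE ji andbF.
Qed.

Lemma convex_stochastic :
  convex_set (stochastic : set (convex_lmodType 'M[R]_d)).
Proof.
move=> P Q t /set_mem Ps /set_mem Qs; apply: mem_set => i.
have t0 : 0 <= t%:inum by [].
have t1 : 0 <= 1 - t%:inum by rewrite subr_ge0.
split=> [j|].
  rewrite !mxE addr_ge0 // mulr_ge0 //; first by have := (Ps i).1 j; rewrite mxE.
  by have := (Qs i).1 j; rewrite mxE.
have sum_row P' : stochastic P' -> \sum_j P' i j = 1.
  by move=> P's; rewrite -(P's i).2; apply: eq_bigr => j _; rewrite mxE.
under eq_bigr do rewrite !mxE.
by rewrite big_split /= -!mulr_sumr !sum_row // !mulr1 addrC subrK.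
Qed.

Lemma stochastic_replace_row P q i : stochastic P -> simplex q ->
  stochastic (replace_row P q i).
Proof.
move=> Ps qs k; have [->|ki] := eqVneq k i.
  by rewrite (_ : row i _ = q) //; apply/rowP => j; rewrite !mxE eqxx.
rewrite (_ : row k _ = row k P) //; apply/rowP => j.
by rewrite !mxE (negPf ki).
Qed.

Lemma continuous_replace_row q i : continuous (fun P => replace_row P q i).
Proof.
apply: continuous_mx => k j; have [ki|ki] := boolP (k == i).
  rewrite (_ : (fun P => _) = fun=> q 0 j); first exact: cst_continuous.
  by apply/funext => P; rewrite mxE ki.
rewrite (_ : (fun P => _) = fun P => P k j); first exact: continuous_entry.
by apply/funext => P; rewrite mxE (negPf ki).
Qed.

Lemma replace_row_id P i : replace_row P (row i P) i = P.
Proof. by apply/matrixP => k j; rewrite !mxE; case: eqP => // ->. Qed.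

Lemma row_replace_row P q i k :
  row k (replace_row P q i) = if k == i then q else row k P.
Proof. by apply/rowP => j; rewrite !mxE; case: ifP => // _; rewrite mxE. Qed.

End Stochastic.

Theorem theorem1 (R : realType) (d : nat) (d_gt1 : (1 < d)%N)
    (c : 'I_d -> 'I_d -> 'rV[R]_d -> 'M[R]_d -> R)
    (e_convex : forall (pi V : 'rV[R]_d) (P : 'M[R]_d) (i : 'I_d),
       simplex pi -> stochastic P ->
       convex_function simplex
         (fun q : 'rV[R]_d => avg_cost c i pi (replace_row P q i) V))
    (e_continuous : forall (pi V : 'rV[R]_d) (i : 'I_d),
       simplex pi ->
       {within stochastic, continuous (fun P : 'M[R]_d => avg_cost c i pi P V)}) :
  forall pi V : 'rV[R]_d, simplex pi ->
    exists P : 'M[R]_d, nash_minimizer c pi V P.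
Proof.
move=> pi V pis.
pose e i P := avg_cost c i pi P V.
pose psi P Q := \sum_i (e i (replace_row P (row i Q) i) - e i P).
have [||||||P Ps PP] := @ky_fan R 'M[R]_d stochastic psi.
- exact: convex_stochastic.
- move=> Q Qs; apply: (@continuous_sum R R (subspace stochastic)) => i P.
  apply: (@continuousB _ _ (subspace stochastic)
    (fun P' => e i (replace_row P' (row i Q) i)) (e i) P); last first.
    exact: e_continuous.
  apply: (within_continuous_comp_in (B := stochastic)
    (continuous_subspaceT (@continuous_replace_row R d (row i Q) i)) _
    (e_continuous _ V i pis)).
  by move=> P' P's; apply: stochastic_replace_row.
(* Row [i] of a convex combination is the combination of the rows [i], so [e_convex] applies to each
   term, and [e i P] is constant in [Q]. *)
- move=> P Ps t Q1 Q2 /set_mem Q1s /set_mem Q2s.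
  rewrite convRE /psi !mulr_sumr -big_split; apply: ler_sum => i _ /=.
  have := e_convex pi V P i pis Ps t (row i Q1) (row i Q2)
    (mem_set (Q1s i)) (mem_set (Q2s i)).
  rewrite convRE (_ : row i (Q1 <| t |> Q2) =
    (row i Q1 : convex_lmodType 'rV[R]_d) <| t |> row i Q2); last first.
    by apply/rowP => j; rewrite !mxE.
  rewrite /e /unstable.onem; lra.
- by move=> P Ps; apply: sumr_ge0 => i _; rewrite replace_row_id subrr.
- exact: compact_stochastic.
- by exists 1%:M => i; rewrite row1; exact: simplex_delta.
exists P; split=> // i q qs.
(* The test matrix differs from [P] at most in row [i], so [psi] reduces to its term for [i]. *)
have := PP (replace_row P q i) (stochastic_replace_row i Ps qs).
rewrite /psi (bigD1 i) //= big1 ?addr0 => [|k ki].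
  by rewrite row_replace_row eqxx subr_ge0.
by rewrite row_replace_row (negPf ki) replace_row_id subrr.
Qed.
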